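(* Let $w_1, \dots, w_n \in \mathbb{R}^n$ be vectors with $\|w_i\|_2 \leq 1$, and let $W$ be the $n \times n$ matrix with the $w_i$ as columns. Then a unit vector $x \in S^{n-1}$ with \[\|Wx\|_\infty = O\left(\frac{1}{\sqrt{n}}\right)\] can be found in time polynomial in $n$.
   Context: $S^{n-1} = \{x \in \mathbb{R}^n : \|x\|_2 = 1\}$. The implicit constant in $O(\cdot)$ is absolute. *)

(* Defs.v *)
From HB Require Import structures.
From mathcomp Require Import all_boot all_order all_algebra.
From mathcomp Require Import reals normedtype.

Set Implicit Arguments.
Unset Strict Implicit.
Unset Printing Implicit Defensive.

Import Order.TTheory GRing.Theory Num.Theory.
Import numFieldNormedType.Exports.
Local Open Scope ring_scope.

(* MathComp-Analysis norms matrices by the largest modulus of an entry, so the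
   norm `|v| of a column vector is the sup norm; the Euclidean norm is this. *)
Definition l2norm (R : realType) (n : nat) (v : 'cV[R]_n) : R :=
  Num.sqrt (\sum_i v i 0 ^+ 2).

(** * Real RAM

   Uniform algorithms over the reals are programs of a structured real RAM:
   exact real arithmetic (with square roots) and comparisons at unit cost, and
   a separate natural-number memory for sizes, counters and addresses.  The
   syntax does not mention R: the only real constants are the naturals, and one
   finite program serves all dimensions.  There is no rounding from reals to
   naturals, and naturals have only addition and truncated subtraction, so that
   neither unit-cost floor nor repeated squaring of naturals is available. *)

Inductive nexp : Type :=
| NConst of nat
| NCell of nexp                      (* indirect addressing *)
| NAdd of nexp & nexp
| NSub of nexp & nexp.

(* Real cells are addressed by triples of naturals; RCell a i j reads as entry
   (i, j) of the array a. *)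
Inductive rexp : Type :=
| ROfNat of nexp
| RCell of nexp & nexp & nexp
| RAdd of rexp & rexp
| RSub of rexp & rexp
| RMul of rexp & rexp
| RDiv of rexp & rexp
| RSqrt of rexp.

Inductive bexp : Type :=
| BNLe of nexp & nexp
| BRLe of rexp & rexp
| BNot of bexp
| BAnd of bexp & bexp.

Inductive cmd : Type :=
| Skip
| NSet of nexp & nexp
| RSet of nexp & nexp & nexp & rexp
| Seq of cmd & cmd
| If of bexp & cmd & cmd
| While of bexp & cmd.

Record state (R : realType) : Type := State {
  nmem : nat -> nat;
  rmem : nat -> nat -> nat -> R }.

Fixpoint neval (R : realType) (s : state R) (e : nexp) : nat :=
  match e with
  | NConst k => k
  | NCell a => nmem s (neval s a)
  | NAdd e1 e2 => (neval s e1 + neval s e2)%N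
  | NSub e1 e2 => (neval s e1 - neval s e2)%N
  end.

(* As in MathComp, x / 0 = 0 and the square root of a negative number is 0. *)
Fixpoint reval (R : realType) (s : state R) (e : rexp) : R :=
  match e with
  | ROfNat k => (neval s k)%:R
  | RCell a i j => rmem s (neval s a) (neval s i) (neval s j)
  | RAdd e1 e2 => reval s e1 + reval s e2
  | RSub e1 e2 => reval s e1 - reval s e2
  | RMul e1 e2 => reval s e1 * reval s e2
  | RDiv e1 e2 => reval s e1 / reval s e2
  | RSqrt e1 => Num.sqrt (reval s e1)
  end.

Fixpoint beval (R : realType) (s : state R) (b : bexp) : bool :=
  match b with
  | BNLe e1 e2 => (neval s e1 <= neval s e2)%N
  | BRLe e1 e2 => reval s e1 <= reval s e2
  | BNot b1 => ~~ beval s b1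
  | BAnd b1 b2 => beval s b1 && beval s b2
  end.

Definition nset (R : realType) (s : state R) (a v : nat) : state R :=
  State (fun b => if b == a then v else nmem s b) (rmem s).

Definition rset (R : realType) (s : state R) (a i j : nat) (v : R) : state R :=
  State (nmem s)
    (fun b k l => if [&& b == a, k == i & l == j] then v else rmem s b k l).

(* exec P s t s': started in s, the program P halts in s' after t steps.  Each
   assignment, Skip and test costs one step; a program is a fixed finite text,
   so this counts elementary operations up to a factor depending only on P. *)
Inductive exec (R : realType) : cmd -> state R -> nat -> state R -> Prop :=
| exec_skip s : exec Skip s 1 s
| exec_nset a e s : exec (NSet a e) s 1 (nset s (neval s a) (neval s e))
| exec_rset a i j e s :
    exec (RSet a i j e) s 1
      (rset s (neval s a) (neval s i) (neval s j) (reval s e))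
| exec_seq P Q s t s' t' s'' :
    exec P s t s' -> exec Q s' t' s'' -> exec (Seq P Q) s (t + t')%N s''
| exec_if_true b P Q s t s' :
    beval s b -> exec P s t s' -> exec (If b P Q) s t.+1 s'
| exec_if_false b P Q s t s' :
    ~~ beval s b -> exec Q s t s' -> exec (If b P Q) s t.+1 s'
| exec_while_false b P s :
    ~~ beval s b -> exec (While b P) s 1 s
| exec_while_true b P s t s' t' s'' :
    beval s b -> exec P s t s' -> exec (While b P) s' t' s'' ->
    exec (While b P) s (t + t').+1 s''.

Lemma exec_det (R : realType) (P : cmd) (s : state R) (t1 t2 : nat)
    (s1 s2 : state R) :
  exec P s t1 s1 -> exec P s t2 s2 -> t1 = t2 /\ s1 = s2.
Proof.
move=> H; elim: H t2 s2 => {P s t1 s1}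
  [s|a e s|a i j e s|P Q s t s' t' s'' _ IH1 _ IH2|b P Q s t s' hb _ IH
  |b P Q s t s' hb _ IH|b P s hb|b P s t s' t' s'' hb _ IH1 _ IH2] t2 s2 H2;
inversion H2; subst => //;
repeat match goal with
| h1 : is_true (beval ?u ?c), h2 : is_true (~~ beval ?u ?c) |- _ =>
    by rewrite h1 in h2
| IH : (forall t s, exec ?c ?u t s -> _), h : exec ?c ?u _ _ |- _ =>
    case: (IH _ _ h) => ??; subst; clear h
end; by [].
Qed.

(* Natural cell 0 holds n, array 0 holds A, everything else is 0. *)
Definition input (R : realType) (n : nat) (A : 'M[R]_n) : state R :=
  State (fun a => if a == 0%N then n else 0%N)
    (fun a i j =>
       match a, insub i, insub j with
       | 0%N, Some i', Some j' => A i' j'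
       | _, _, _ => 0
       end).

(* The result vector is read off the first column of array 1. *)
Definition output (R : realType) (n : nat) (s : state R) : 'cV[R]_n :=
  \col_(i < n) rmem s 1 i 0.

(* Main.v *)
Require Import Defs.
From HB Require Import structures.
From mathcomp Require Import all_boot all_order all_algebra.
From mathcomp Require Import reals normedtype.
From mathcomp Require Import lra ring zify.

Set Implicit Arguments.
Unset Strict Implicit.
Unset Printing Implicit Defensive.

Import Order.TTheory GRing.Theory Num.Theory.
Import numFieldNormedType.Exports.
Local Open Scope ring_scope.

(** Walk inside the polytope [|(W x)_j| <= 1] from [x = 0], keeping
    [slack x = 2 |x|^2 - |W x|^2 >= 0].  Let Q be the orthogonal projector onto
    the complement of the tight rows of W; its rank is n minus their number.
    Since [tr (Q W^T W Q) <= |W|_F^2 <= n], as long as [2 rank Q > n] some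
    column y of Q has [slack y > 0].  Choosing the sign of y so that the
    bilinear form of slack is nonnegative at (x, y), moving along y keeps
    [slack x >= 0]; move until a new row becomes tight.  After at most n steps
    at least n/2 rows are tight, so [2 |x|^2 >= |W x|^2 >= n/2], and
    normalizing x gives the constant 2.  If [W y = 0], then y itself is a
    solution. *)

(** * Loop programs *)

(* PFor c p runs p for c = 0, ..., n - 1, where n is the content of cell 0; a
   program whose loops are all of this form takes polynomial time. *)
Inductive prog : Type :=
| PNSet of nat & nexp
| PRSet of nat & nexp & nexp & rexp
| PSeq of prog & prog
| PIf of bexp & prog & prog
| PFor of nat & prog.

Fixpoint compile (p : prog) : cmd :=
  match p with
  | PNSet c e => NSet (NConst c) e
  | PRSet a i j e => RSet (NConst a) i j e
  | PSeq p q => Seq (compile p) (compile q)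
  | PIf b p q => If b (compile p) (compile q)
  | PFor c p =>
      Seq (NSet (NConst c) (NConst 0))
        (While (BNLe (NAdd (NCell (NConst c)) (NConst 1)) (NCell (NConst 0)))
          (Seq (compile p)
            (NSet (NConst c) (NAdd (NCell (NConst c)) (NConst 1)))))
  end.

Fixpoint writes (p : prog) : seq nat :=
  match p with
  | PNSet c _ => [:: c]
  | PRSet _ _ _ _ => [::]
  | PSeq p q | PIf _ p q => writes p ++ writes q
  | PFor c p => c :: writes p
  end.

(** Protects cell 0, which holds the loop bound, and keeps each loop body from touching its own
    counter; hence every loop makes exactly as many passes as cell 0 says. *)
Fixpoint wf (p : prog) : bool :=
  match p with
  | PNSet c _ => c != 0%N
  | PRSet _ _ _ _ => true
  | PSeq p q | PIf _ p q => wf p && wf q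
  | PFor c p => [&& c != 0%N, c \notin writes p & wf p]
  end.

(** An upper bound as a polynomial in the content of cell 0; branches are added since a maximum need
    not be a polynomial. In a loop, 2 per pass pays for the increment and the test, and the last 2
    for the initial assignment and the failing test. *)
Fixpoint cost (p : prog) : {poly nat} :=
  match p with
  | PNSet _ _ | PRSet _ _ _ _ => 1
  | PSeq p q => cost p + cost q
  | PIf _ p q => cost p + cost q + 1
  | PFor _ p => (cost p + 2%N%:P) * 'X + 2%N%:P
  end.

Section Run.
Variable R : realType.
Implicit Types (s : state R) (p : prog).

(** Reads the loop bound once, on entry; [wf] makes this agree with the [While] of [compile]. *)
Fixpoint run p s : state R :=
  match p with
  | PNSet c e => nset s c (neval s e)
  | PRSet a i j e => rset s a (neval s i) (neval s j) (reval s e)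
  | PSeq p q => run q (run p s)
  | PIf b p q => if beval s b then run p s else run q s
  | PFor c p =>
      iteri (nmem s 0) (fun i s' => nset (run p s') c i.+1) (nset s c 0)
  end.

Lemma run_frame p s c : c \notin writes p -> nmem (run p s) c = nmem s c.
Proof.
elim: p s => [d e|a i j e|p IHp q IHq|b p IHp q IHq|d p IHp] s //=.
- by rewrite inE => /negPf ->.
- by rewrite mem_cat negb_or => /andP[/IHp hp /IHq hq]; rewrite hq hp.
- by rewrite mem_cat negb_or => /andP[/IHp hp /IHq hq]; case: ifP.
rewrite inE negb_or => /andP[/negPf cd /IHp hp].
by elim: (nmem s 0) => [|m IHm] /=; rewrite cd // hp.
Qed.

Lemma wf_writes0 p : wf p -> 0%N \notin writes p.
Proof.
elim: p => [d e|a i j e|p IHp q IHq|b p IHp q IHq|d p IHp] //=.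
- by rewrite inE eq_sym.
- by case/andP=> /IHp hp /IHq hq; rewrite mem_cat negb_or hp.
- by case/andP=> /IHp hp /IHq hq; rewrite mem_cat negb_or hp.
- by case/and3P=> d0 _ /IHp hp; rewrite inE negb_or eq_sym d0.
Qed.

Lemma exec_run p s :
  wf p -> exists2 t, exec (compile p) s t (run p s)
                   & (t <= (cost p).[nmem s 0]%R)%N.
Proof.
elim: p s => [d e|a i j e|p IHp q IHq|b p IHp q IHq|d p IHp] s /=.
- by move=> _; exists 1%N; [exact: exec_nset|rewrite hornerC].
- by move=> _; exists 1%N; [exact: exec_rset|rewrite hornerC].
- case/andP=> wp wq.
  have [t ht lt] := IHp s wp; have [u hu lu] := IHq (run p s) wq.
  exists (t + u)%N; first exact: exec_seq ht hu.
  by rewrite hornerD leq_add // (leq_trans lu) // run_frame // wf_writes0.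
- case/andP=> wp wq; case: ifPn => hb.
    have [t ht lt] := IHp s wp; exists t.+1; first exact: exec_if_true.
    by rewrite !hornerD hornerC !natrDE addn1 ltnS (leq_trans lt) // leq_addr.
  have [t ht lt] := IHq s wq; exists t.+1; first exact: exec_if_false.
  by rewrite !hornerD hornerC !natrDE addn1 ltnS (leq_trans lt) // leq_addl.
case/and3P=> d0 dp wp; set n := nmem s 0.
set step := fun i s' => nset (run p s') d i.+1.
set st := fun m => iteri m step (nset s d 0).
have st0 m : nmem (st m) 0 = n.
  elim: m => [|m IHm] /=; rewrite eq_sym (negPf d0) //.
  by rewrite run_frame // wf_writes0.
have std m : nmem (st m) d = m.
  by case: m => [|m] /=; rewrite eqxx.
(* Induction on the number k of passes left, starting from the state after m passes. *)
suff H k m : (k + m)%N = n -> exists2 t,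
  exec (While (BNLe (NAdd (NCell (NConst d)) (NConst 1)) (NCell (NConst 0)))
          (Seq (compile p)
            (NSet (NConst d) (NAdd (NCell (NConst d)) (NConst 1)))))
    (st m) t (st n) & (t <= ((cost p).[n]%R + 2) * k + 1)%N.
  have [t ht lt] := H n 0 (addn0 n).
  exists (1 + t)%N; first by apply: exec_seq ht; exact: exec_nset.
  rewrite hornerD hornerM hornerX hornerD !hornerC !natrDE natrME.
  by rewrite addnC -[2%N in leqRHS]/(1 + 1)%N addnA leq_add2r.
elim: k m => [|k IHk] m.
  rewrite add0n => ->; exists 1%N; last by rewrite muln0.
  by apply: exec_while_false; rewrite /= std st0 addn1 ltnn.
rewrite addSn -addnS => kmn; have [t ht lt] := IHk _ kmn.
have [u hu lu] := IHp (st m) wp.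
exists ((u + 1) + t).+1; last first.
  by rewrite st0 in lu; lia.
apply: exec_while_true ht.
  by rewrite /= std st0 addn1 -kmn leq_addl.
apply: exec_seq hu _.
have -> : st m.+1 = nset (run p (st m)) (neval (run p (st m)) (NConst d))
    (neval (run p (st m)) (NAdd (NCell (NConst d)) (NConst 1))).
  by rewrite /= run_frame // std addn1.
exact: exec_nset.
Qed.

End Run.

Lemma run_PSeq (R : realType) p q (s : state R) :
  run (PSeq p q) s = run q (run p s).
Proof. by []. Qed.

(** Besides the invariant, the body may use that its counter holds i, since every pass starts right
    after that assignment. *)
Lemma run_PFor_ind (R : realType) (I : nat -> state R -> Prop) c p s :
  I 0%N (nset s c 0) ->
  (forall i t, (i < nmem s 0)%N -> nmem t c = i -> I i t ->
     I i.+1 (nset (run p t) c i.+1)) ->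
  I (nmem s 0) (run (PFor c p) s).
Proof.
move=> I0 IS /=; set step := fun i t => nset (run p t) c i.+1.
suff H m : (m <= nmem s 0)%N -> I m (iteri m step (nset s c 0)) by exact: H.
elim: m => [//|m IHm] lt_m; apply: IS => //; last exact/IHm/ltnW.
by case: (m) => [|k] /=; rewrite eqxx.
Qed.

(** * Loops over arrays: map, sum and scan *)

Definition upd (T : Type) (f : nat -> T) (a : nat) (v : T) : nat -> T :=
  fun b => if b == a then v else f b.

Definition PMap (a : nat) (e : rexp) : prog :=
  PFor 1 (PFor 2 (PRSet a (NCell (NConst 1)) (NCell (NConst 2)) e)).

(** The summation index runs outermost, so that a sum is an iterated [PMap]; [e] finds the row,
    column and summation index in cells 1, 2 and 3. *)
Definition PSum (a : nat) (e : rexp) : prog :=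
  PSeq (PMap a (ROfNat (NConst 0)))
    (PFor 3 (PMap a
      (RAdd (RCell (NConst a) (NCell (NConst 1)) (NCell (NConst 2))) e))).

(* Leaves in cell c the last candidate accepted by b, or n if there is none;
   b may consult the current value of cell c. *)
Definition PScan (c : nat) (b : bexp) : prog :=
  PSeq (PNSet c (NCell (NConst 0)))
    (PFor 1 (PIf b (PNSet c (NCell (NConst 1))) (PNSet 2 (NConst 0)))).

Section Rep.
Variables (R : realType) (n : nat).
Implicit Types (s t : state R) (E : nat -> 'M[R]_n) (nu : nat -> nat).

Definition mat s a : 'M[R]_n := \matrix_(i, j) rmem s a i j.

Lemma matE s a (i j : 'I_n) : rmem s a i j = mat s a i j.
Proof. by rewrite mxE. Qed.

(* Cells 1, 2 and 3 are loop counters. *)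
Definition rep s E nu :=
  [/\ nmem s 0 = n, forall a, mat s a = E a
    & forall c, (3 < c)%N -> nmem s c = nu c].

Lemma rep_nset s E nu c v :
  rep s E nu -> (0 < c <= 3)%N -> rep (nset s c v) E nu.
Proof.
case=> s0 sE sn /andP[c0 c3]; split=> [|a|d d3] /=.
- by rewrite eq_sym (gtn_eqF c0).
- by rewrite -sE.
- by rewrite (gtn_eqF (leq_ltn_trans c3 d3)) sn.
Qed.

(** Updates in place are allowed: for the entry (i, j), [e] may read the old value of that entry and
    all other arrays, but no other entry of [a]. Cell 3 is preserved so that the map can be the loop
    body in [PSum]. *)
Lemma rep_PMap s E nu a e (M : 'M[R]_n) :
  rep s E nu ->
  (forall t (i j : 'I_n), nmem t 0 = n -> nmem t 1 = i -> nmem t 2 = j ->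
     nmem t 3 = nmem s 3 -> (forall c, (3 < c)%N -> nmem t c = nu c) ->
     (forall b, b != a -> mat t b = E b) -> mat t a i j = E a i j ->
     reval t e = M i j) ->
  rep (run (PMap a e) s) (upd E a M) nu /\
  nmem (run (PMap a e) s) 3 = nmem s 3.
Proof.
move=> sr eM.
(* [P] is the invariant of the outer loop and [Q] of the inner one: entries before the current
   position in row-major order hold [M], the others their old values. *)
pose P i t := rep t (upd E a (\matrix_(k, l) if (k < i)%N then M k l
  else E a k l)) nu /\ nmem t 3 = nmem s 3.
pose Q i j t := rep t (upd E a (\matrix_(k, l) if ((k < i) || (k == i :> nat)
  && (l < j))%N then M k l else E a k l)) nu /\ nmem t 3 = nmem s 3
  /\ nmem t 1 = i.
have s0 : nmem s 0 = n by case: sr.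
suff: P (nmem s 0) (run (PMap a e) s).
  have Mn : \matrix_(k, l) (if (k < n)%N then M k l else E a k l) = M.
    by apply/matrixP => k l; rewrite mxE ltn_ord.
  by rewrite /P s0 Mn.
apply: run_PFor_ind => [|i t lin t1 [tr t3]].
  split=> //; have [_ sE sn] := rep_nset 0 sr (isT : 0 < 1 <= 3)%N.
  split=> // b; rewrite sE /upd; case: eqP => // ->.
  by apply/matrixP=> k l; rewrite mxE.
have t0 : nmem t 0 = n by case: tr.
have : Q i (nmem t 0) (run (PFor 2 (PRSet a (NCell (NConst 1))
    (NCell (NConst 2)) e)) t).
  apply: run_PFor_ind => [|j u ljn u2 [ur [u3 u1]]].
    split=> //; have [_ tE tn] := rep_nset 0 tr (isT : 0 < 2 <= 3)%N.
    split=> // b; rewrite tE /upd; case: eqP => // _.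
    by apply/matrixP=> k l; rewrite !mxE ltn0 andbF orbF.
  split=> //; apply: rep_nset => //; case: ur => u0 uE un; split=> // b.
  rewrite s0 t0 in lin ljn.
  have lM : reval u e = M (Ordinal lin) (Ordinal ljn).
    apply: eM => //.
      by move=> c cb; rewrite uE /upd (negPf cb).
    by rewrite uE /upd eqxx mxE /= ltnn eqxx ltnn.
  apply/matrixP=> k l; rewrite mxE /= u1 u2 lM matE uE /upd.
  case: eqP => //= _; rewrite !mxE.
  rewrite ltnS [(l <= j)%N]leq_eqVlt.
  case: (eqVneq (k : nat) i) => [ki|//]; case: (eqVneq (l : nat) j) => [lj|//].
  rewrite /= orbT; congr (M _ _); exact/val_inj.
case=> ur [u3 _]; split=> //; apply: rep_nset => //.
case: ur => u0 uE un; split=> // b; rewrite uE /upd; case: eqP => // _.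
apply/matrixP=> k l; rewrite !mxE t0 ltn_ord andbT ltnS.
by rewrite [in RHS]leq_eqVlt orbC.
Qed.

(** The value of [e] must not depend on [a], which holds partial sums during the loop. *)
Lemma rep_PSum s E nu a e (F : 'I_n -> 'I_n -> 'I_n -> R) :
  rep s E nu ->
  (forall t (i j k : 'I_n), nmem t 0 = n -> nmem t 1 = i -> nmem t 2 = j ->
     nmem t 3 = k -> (forall c, (3 < c)%N -> nmem t c = nu c) ->
     (forall b, b != a -> mat t b = E b) -> reval t e = F i j k) ->
  rep (run (PSum a e) s) (upd E a (\matrix_(i, j) \sum_k F i j k)) nu.
Proof.
move=> sr eF.
pose P m t := rep t (upd E a
  (\matrix_(i, j) \sum_(k < n | (k < m)%N) F i j k)) nu.
rewrite /PSum run_PSeq; set s1 := run (PMap _ _) s.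
have [s1r _] : rep s1 (upd E a 0) nu /\ nmem s1 3 = nmem s 3.
  by apply: rep_PMap => // t i j *; rewrite mxE.
have s10 : nmem s1 0 = n by case: s1r.
have : P (nmem s1 0) (run (PFor 3 (PMap a (RAdd (RCell (NConst a)
    (NCell (NConst 1)) (NCell (NConst 2))) e))) s1).
  apply: run_PFor_ind => [|m t lmn t3 tr].
    apply: rep_nset => //; case: s1r => _ sE sn; split=> // b.
    rewrite sE /upd; case: eqP => // _; apply/matrixP=> k l.
    by rewrite !mxE big_pred0.
  apply: rep_nset => //; rewrite s10 in lmn.
  pose M : 'M[R]_n := \matrix_(i, j) \sum_(k < n | (k < m.+1)%N) F i j k.
  set u := run _ t; have [] : rep u (upd (upd E a (\matrix_(i, j)
      \sum_(k < n | (k < m)%N) F i j k)) a M) nu /\ nmem u 3 = nmem t 3.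
    apply: rep_PMap => // v i j v0 v1 v2 v3 vn vE va /=.
    rewrite (eF v i j (Ordinal lmn)) ?v3 //; last first.
      by move=> b ba; rewrite vE // /upd (negPf ba).
    rewrite v1 v2 matE va /upd eqxx !mxE [RHS](bigD1 (Ordinal lmn)) //= addrC.
    by congr (_ + _); apply: eq_bigl => k;
      rewrite ltnS -val_eqE /= ltn_neqAle andbC.
  case=> u0 uE un _; split=> // b; rewrite uE /upd; by case: eqP.
rewrite s10 /P => -[r0 rE rn]; split=> // b; rewrite rE /upd; case: eqP => // _.
by apply/matrixP=> i j; rewrite !mxE; apply: eq_bigl => k; rewrite ltn_ord.
Qed.

(** [I i v] relates the indices below i to the current candidate v; the initial v = n means that
    none has been found. *)
Lemma rep_PScan s E nu c b (I : nat -> nat -> Prop) :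
  (3 < c)%N -> rep s E nu -> I 0%N n ->
  (forall t (i : 'I_n) v, nmem t 1 = i -> rep t E (upd nu c v) -> I i v ->
     I i.+1 (if beval t b then nat_of_ord i else v)) ->
  exists2 v, I n v & rep (run (PScan c b) s) E (upd nu c v).
Proof.
move=> c3 sr I0 IS.
rewrite /PScan run_PSeq; set s1 := run (PNSet _ _) s.
have s1r : rep s1 E (upd nu c n).
  case: sr => s0 sE sn; split=> [|a|d d3] /=.
  - by rewrite eq_sym gtn_eqF // (leq_trans _ c3).
  - by rewrite -sE.
  - by rewrite /upd s0 sn.
have s10 : nmem s1 0 = n by case: s1r.
pose P i t := exists2 v, I i v & rep t E (upd nu c v).
rewrite -{1}s10 -/(P _ _); apply: run_PFor_ind => [|i t lin t1 [v Iv tr]].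
  by exists n => //; apply: rep_nset.
rewrite s10 in lin; have := IS t (Ordinal lin) v t1 tr Iv.
set w := (if _ then _ else _) => Iw; exists w => //.
apply: rep_nset => //; rewrite /w {w Iw} /=.
case: ifP => _ /=; last exact: rep_nset.
case: tr => t0 tE tn; split=> [|a|d d3] /=.
- by rewrite eq_sym gtn_eqF // (leq_trans _ c3).
- by rewrite -tE.
- by rewrite /upd t1; case: eqP => // /eqP dc; rewrite tn // /upd (negPf dc).
Qed.

End Rep.

(** * The walk *)

Section Walk.
Variables (R : realType) (n : nat).
Implicit Types (x y : 'cV[R]_n) (A Q : 'M[R]_n) (S : {set 'I_n}).

Definition dot m (x y : 'cV[R]_m) : R := \sum_k x k 0 * y k 0.

Lemma dotE m (x y : 'cV[R]_m) : x^T *m y = (dot x y)%:M.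
Proof.
apply/matrixP=> i j; rewrite !ord1 !mxE eqxx mulr1n.
by apply: eq_bigr => k _; rewrite mxE.
Qed.

Lemma dot_ge0 m (x : 'cV[R]_m) : 0 <= dot x x.
Proof. by apply: sumr_ge0 => k _; rewrite -expr2 sqr_ge0. Qed.

Lemma dot_eq0 m (x : 'cV[R]_m) : dot x x = 0 -> x = 0.
Proof.
move=> x0; apply/colP=> k; rewrite mxE; apply/eqP; rewrite -sqrf_eq0 expr2.
by rewrite (psumr_eq0P _ x0) // => i _; rewrite -expr2 sqr_ge0.
Qed.

Lemma dot_sqrD m (x y : 'cV[R]_m) a :
  dot (x + a *: y) (x + a *: y) = dot x x + 2 * a * dot x y + a ^+ 2 * dot y y.
Proof.
rewrite /dot !mulr_sumr -!big_split; apply: eq_bigr => k _.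
rewrite !mxE /=; ring.
Qed.

Lemma mxtrace_gram A : \tr (A^T *m A) = \sum_j \sum_k A k j ^+ 2.
Proof.
by apply: eq_bigr => j _; rewrite mxE; apply: eq_bigr => k _; rewrite mxE.
Qed.

Definition proj Q := Q^T = Q /\ Q *m Q = Q.

(** The complement [1 - Q] is a projector too, so the difference of the traces is the squared
    Frobenius norm of [A (1 - Q)]. *)
Lemma mxtrace_mul_proj_le A Q : proj Q -> \tr (A *m Q *m A^T) <= \tr (A *m A^T).
Proof.
case=> QT QQ; rewrite -subr_ge0 -raddfB /=.
have PP : (1%:M - Q) *m (1%:M - Q) = 1%:M - Q.
  by rewrite mulmxBl !mulmxBr !mulmx1 mul1mx QQ subrr subr0.
have -> : A *m A^T - A *m Q *m A^T = (A *m (1%:M - Q)) *m (A *m (1%:M - Q))^T.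
  rewrite trmx_mul [(1%:M - Q)^T]raddfB /= trmx1 QT mulmxA
    -[A *m (1%:M - Q) *m _]mulmxA PP.
  by rewrite mulmxBr mulmx1 mulmxBl.
rewrite mxtrace_mulC mxtrace_gram.
by apply: sumr_ge0 => j _; apply: sumr_ge0 => k _; rewrite sqr_ge0.
Qed.

(** Removes from the range of Q the line spanned by g, which lies in it. As Q is a projector, the
    product of g with r equals that of g with itself, so the correction cancels [Q r] exactly.
    Traces stand for ranks. *)
Lemma proj_downdate Q (r : 'cV[R]_n) (g := Q *m r)
    (Q' := Q - (dot g g)^-1 *: (g *m g^T)) :
  proj Q -> g != 0 ->
  [/\ proj Q', \tr Q' = \tr Q - 1, Q' *m r = 0
    & forall h : 'cV[R]_n, Q *m h = 0 -> Q' *m h = 0].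
Proof.
move=> [QT QQ] g0.
have gg0 : dot g g != 0 by apply: contraNneq g0 => /dot_eq0 ->.
have Qg : Q *m g = g by rewrite mulmxA QQ.
have gQ : g^T *m Q = g^T by rewrite -{1}QT -trmx_mul Qg.
have gr : g^T *m r = (dot g g)%:M.
  by rewrite -dotE -{1}gQ -mulmxA.
have ggg : (g *m g^T) *m (g *m g^T) = dot g g *: (g *m g^T).
  by rewrite mulmxA -[_ *m g]mulmxA dotE mul_mx_scalar -scalemxAl.
split.
- split; first by rewrite raddfB /= linearZ /= trmx_mul trmxK QT.
  have QG : Q *m (g *m g^T) = g *m g^T by rewrite mulmxA Qg.
  have GQ : (g *m g^T) *m Q = g *m g^T by rewrite -mulmxA gQ.
  rewrite mulmxBl !mulmxBr -!scalemxAl -!scalemxAr QQ QG GQ ggg.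
  by rewrite !scalerA -mulrA mulVf // mulr1 subrr subr0.
- rewrite [\tr Q']raddfB /= mxtraceZ mxtrace_mulC dotE mxtrace_scalar.
  by rewrite mulVf.
- rewrite mulmxBl -/g -scalemxAl -mulmxA gr mul_mx_scalar scalerA mulVf //.
  by rewrite scale1r subrr.
- move=> h Qh; rewrite mulmxBl Qh -scalemxAl -mulmxA /g trmx_mul QT.
  by rewrite -[_ *m h]mulmxA Qh !mulmx0 scaler0 subrr.
Qed.

Variable W : 'M[R]_n.

Definition slack x : R := 2 * dot x x - dot (W *m x) (W *m x).

(** The polarization of [slack]. *)
Definition slack_form x y : R := 2 * dot x y - dot (W *m x) (W *m y).

(** Averaging: as [Q^T Q = Q], the slacks of the columns sum to [2 tr Q - tr (W Q W^T)], and the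
    subtracted trace is at most the squared Frobenius norm of W. *)
Lemma exists_slack_gt0 Q :
  \sum_j \sum_i W i j ^+ 2 <= n%:R -> proj Q -> n%:R < 2 * \tr Q ->
  exists j, 0 < slack (col j Q).
Proof.
move=> W1 pQ nQ; apply/existsP; apply: contraLR nQ.
rewrite negb_exists => /forallP nslack; rewrite -leNgt.
have : \sum_j slack (col j Q) <= 0.
  by apply: sumr_le0 => j _; rewrite leNgt.
have -> : \sum_j slack (col j Q) = 2 * \tr Q - \tr (W *m Q *m W^T).
  have -> : W *m Q *m W^T = (W *m Q) *m (W *m Q)^T.
    by case: pQ => QT QQ; rewrite trmx_mul QT mulmxA -[_ *m Q *m Q]mulmxA QQ.
  have -> : \tr Q = \tr (Q^T *m Q) by case: pQ => -> ->.
  rewrite mxtrace_gram [\tr (_ *m _^T)]mxtrace_mulC mxtrace_gram.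
  rewrite mulr_sumr -sumrB.
  apply: eq_bigr => j _; rewrite /slack /dot; congr (_ * _ - _).
    by apply: eq_bigr => k _; rewrite !mxE expr2.
  by apply: eq_bigr => k _; rewrite [col j Q]colE mulmxA -colE !mxE expr2.
have := mxtrace_mul_proj_le W pQ.
rewrite [\tr (W *m W^T)]mxtrace_mulC mxtrace_gram; lra.
Qed.

(** The trace equation says that Q has rank n - |S|. S may miss tight rows: when several are hit at
    once, only one is recorded. *)
Definition walk_inv x Q S :=
  [/\ proj Q, \tr Q + #|S|%:R = n%:R, forall j, (W *m x) j 0 ^+ 2 <= 1,
      forall j, j \in S -> (W *m x) j 0 ^+ 2 = 1 /\ Q *m (row j W)^T = 0
    & 0 <= slack x].

(** The bound [|W x|_oo <= 2 |x| / sqrt n], squared to avoid roots and homogeneous in x, so that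
    normalization can wait. *)
Definition good x :=
  0 < dot x x /\ forall j, n%:R * (W *m x) j 0 ^+ 2 <= 4 * dot x x.

Lemma walk_inv_good x Q S :
  (0 < n)%N -> walk_inv x Q S -> (n <= 2 * #|S|)%N -> good x.
Proof.
move=> n0 [_ _ x1 xS xslack] nS.
have SW : #|S|%:R <= dot (W *m x) (W *m x).
  rewrite -sum1_card natr_sum /dot [leRHS](bigID (mem S)) /= -[leLHS]addr0.
  apply: lerD; last by apply: sumr_ge0 => k _; rewrite -expr2 sqr_ge0.
  by apply: ler_sum => k kS; rewrite -expr2; case: (xS k kS) => ->.
have nS' : n%:R <= 2 * #|S|%:R :> R by rewrite -natrM ler_nat.
have n4 : n%:R <= 4 * dot x x by rewrite /slack in xslack; lra.
have n0' : 0 < n%:R :> R by rewrite ltr0n.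
split=> [|j]; first lra.
by apply: le_trans n4; rewrite ler_piMr // ltW.
Qed.

(* For [|v| <= 1] and [z <> 0], the time at which [v + a z] leaves [-1, 1]. *)
Definition hit_time (v z : R) : R := (Num.sqrt (z ^+ 2) - z * v) / z ^+ 2.

Lemma sqr_le1 (v : R) : -1 <= v <= 1 -> v ^+ 2 <= 1.
Proof. by case/andP=> v1 v2; nra. Qed.

Lemma hit_timeP (v z : R) : v ^+ 2 <= 1 -> z != 0 ->
  [/\ 0 <= hit_time v z, (v + hit_time v z * z) ^+ 2 = 1
    & forall a, 0 <= a <= hit_time v z -> (v + a * z) ^+ 2 <= 1].
Proof.
move=> v1 z0; have {v1}: -1 <= v <= 1 by nra.
rewrite /hit_time sqrtr_sqr => /andP[v1 v2].
have [z1|z1] := leP 0 z.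
  have {z1}z1 : 0 < z by rewrite lt_neqAle eq_sym z0.
  (* For z > 0 the bound reached is 1; in the other case it is -1. *)
  have -> : (`|z| - z * v) / z ^+ 2 = (1 - v) / z.
    by rewrite ger0_norm 1?ltW //; field.
  split.
  - by apply: divr_ge0; lra.
  - have -> : v + (1 - v) / z * z = 1 by field.
    by rewrite expr1n.
  - move=> a /andP[a0]; rewrite ler_pdivlMr // => az; apply: sqr_le1.
    by have := mulr_ge0 a0 (ltW z1); lra.
have -> : (`|z| - z * v) / z ^+ 2 = (1 + v) / - z.
  by rewrite ltr0_norm //; field.
have nz : 0 < - z by lra.
split.
- by apply: divr_ge0; lra.
- have -> : v + (1 + v) / - z * z = -1 by field.
  by rewrite sqrrN expr1n.
- move=> a /andP[a0]; rewrite ler_pdivlMr // => az; apply: sqr_le1.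
  by have := mulr_ge0 a0 (ltW nz); lra.
Qed.

(** The smallest hitting time among the moving rows keeps all rows in [-1, 1] and makes row j tight.
    As y lies in the range of Q, the rows in S do not move and stay tight. *)
Lemma walk_inv_step x Q S y j
    (a := hit_time ((W *m x) j 0) ((W *m y) j 0)) (g := Q *m (row j W)^T) :
  walk_inv x Q S -> Q *m y = y -> 0 <= slack y -> 0 <= slack_form x y ->
  (W *m y) j 0 != 0 ->
  (forall k, (W *m y) k 0 != 0 ->
     a <= hit_time ((W *m x) k 0) ((W *m y) k 0)) ->
  walk_inv (x + a *: y) (Q - (dot g g)^-1 *: (g *m g^T)) (j |: S) /\ j \notin S.
Proof.
move=> [pQ trQ x1 xS xslack] Qy yslack xy zj amin.
have rowW k : (row k W)^T^T *m y = ((W *m y) k 0)%:M.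
  by apply/matrixP=> i l; rewrite trmxK -row_mul !ord1 !mxE eqxx.
have zE k : ((W *m y) k 0)%:M = (Q *m (row k W)^T)^T *m y.
  by case: (pQ) => QT _; rewrite trmx_mul QT -mulmxA Qy rowW.
have z0 k : Q *m (row k W)^T = 0 -> (W *m y) k 0 = 0.
  move=> Qk; have := zE k; rewrite Qk trmx0 mul0mx => /matrixP/(_ 0 0).
  by rewrite !mxE eqxx.
(* If g were 0, row j would not move; the same argument shows that j is not in S. *)
have g0 : g != 0 by apply: contraNneq zj => /z0 ->.
have jS : j \notin S by apply: contraNN zj => /xS[_ /z0 ->].
split=> //; have [pQ' trQ' Q'j Q'k] := proj_downdate pQ g0.
have [a0 aj _] := hit_timeP (x1 j) zj; rewrite -/a in a0 aj.
have WxE k : (W *m (x + a *: y)) k 0 = (W *m x) k 0 + a * (W *m y) k 0.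
  by rewrite mulmxDr -scalemxAr !mxE.
split=> //.
- by rewrite trQ' cardsU1 jS add1n -natr1 -trQ; lra.
- move=> k; rewrite WxE; have [->|zk] := eqVneq ((W *m y) k 0) 0.
    by rewrite mulr0 addr0.
  by have [_ _] := hit_timeP (x1 k) zk; apply; rewrite a0 amin.
- move=> k; rewrite WxE in_setU1 => /orP[/eqP ->|kS]; first by split.
  have [xk Qk] := xS k kS; rewrite z0 // mulr0 addr0; split=> //.
  exact: Q'k.
- move: xslack yslack xy; rewrite /slack /slack_form.
  (* The new slack is [slack x + 2 a slack_form x y + a^2 slack y], a sum of nonnegative terms. *)
  rewrite mulmxDr -scalemxAr !dot_sqrD => xslack yslack xy.
  have := mulr_ge0 a0 xy; have := mulr_ge0 (sqr_ge0 a) yslack; lra.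
Qed.

Lemma slack_good y : 0 < slack y -> W *m y = 0 -> good y.
Proof.
rewrite /slack => ys Wy; have y0 := dot_ge0 (W *m y).
split=> [|j]; first lra.
by rewrite Wy mxE expr0n mulr0; lra.
Qed.

End Walk.

(** * The program *)

Definition cell k : nexp := NCell (NConst k).
Definition entry (a : nat) (i j : nexp) : rexp := RCell (NConst a) i j.
Definition rnat k : rexp := ROfNat (NConst k).
Definition rsq e : rexp := RMul e e.
(** Resetting cell 2 counts as doing nothing, because [rep] does not record that cell. *)
Definition pskip : prog := PNSet 2 (NConst 0).

(* The truncated subtractions make the entry (i, j) equal to [i == j]. *)
Definition pinit : prog :=
  PMap 2 (ROfNat (NSub (NConst 1)
    (NAdd (NSub (cell 1) (cell 2)) (NSub (cell 2) (cell 1))))).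

(* Natural cells: 4, the column of Q chosen; 5, the row hit first; 6, the step
   counter.  Arrays: 0, W; 1, x; 2, Q; 3, W Q; 4, W x; 5, the slack of the
   columns of Q; 6, slack_form of x and the columns of Q; 7, the direction y;
   8, W y; 9, the hitting times; 10, g = Q r for r the row hit; 11, g . g.
   Vectors are stored as n x n arrays, read off their column 0. *)
Definition ppick : prog :=
  PSeq (PSum 3 (RMul (entry 0 (cell 1) (cell 3)) (entry 2 (cell 3) (cell 2))))
  (PSeq (PSum 4 (RMul (entry 0 (cell 1) (cell 3)) (entry 1 (cell 3) (cell 2))))
  (PSeq (PSum 5 (RSub (RMul (rnat 2) (rsq (entry 2 (cell 3) (cell 2))))
                      (rsq (entry 3 (cell 3) (cell 2)))))
  (PSeq (PSum 6 (RSub (RMul (rnat 2) (RMul (entry 1 (cell 3) (NConst 0))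
                                           (entry 2 (cell 3) (cell 2))))
                      (RMul (entry 4 (cell 3) (NConst 0))
                            (entry 3 (cell 3) (cell 2)))))
    (PScan 4 (BNot (BRLe (entry 5 (NConst 0) (cell 1)) (rnat 0))))))).

Definition paim : prog :=
  PSeq (PIf (BRLe (rnat 0) (entry 6 (NConst 0) (cell 4)))
         (PMap 7 (entry 2 (cell 1) (cell 4)))
         (PMap 7 (RSub (rnat 0) (entry 2 (cell 1) (cell 4)))))
  (PSeq (PSum 8 (RMul (entry 0 (cell 1) (cell 3)) (entry 7 (cell 3) (cell 2))))
  (PSeq (PMap 9 (RDiv (RSub (RSqrt (rsq (entry 8 (cell 1) (NConst 0))))
                            (RMul (entry 8 (cell 1) (NConst 0))
                                  (entry 4 (cell 1) (NConst 0))))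
                      (rsq (entry 8 (cell 1) (NConst 0)))))
    (PScan 5 (BAnd (BNot (BRLe (rsq (entry 8 (cell 1) (NConst 0))) (rnat 0)))
      (BNot (BAnd (BNLe (NAdd (cell 5) (NConst 1)) (cell 0))
        (BRLe (entry 9 (cell 5) (NConst 0))
              (entry 9 (cell 1) (NConst 0))))))))).

Definition padvance : prog :=
  PSeq (PMap 1 (RAdd (entry 1 (cell 1) (cell 2))
                     (RMul (entry 9 (cell 5) (NConst 0))
                           (entry 7 (cell 1) (cell 2)))))
  (PSeq (PSum 10 (RMul (entry 2 (cell 1) (cell 3)) (entry 0 (cell 5) (cell 3))))
  (PSeq (PSum 11 (rsq (entry 10 (cell 3) (NConst 0))))
    (PMap 2 (RSub (entry 2 (cell 1) (cell 2))
                  (RDiv (RMul (entry 10 (cell 1) (NConst 0))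
                              (entry 10 (cell 2) (NConst 0)))
                        (entry 11 (NConst 0) (NConst 0))))))).

(* With Q = 0 no column has positive slack, so x no longer changes. *)
Definition pstop : prog :=
  PSeq (PMap 1 (entry 7 (cell 1) (cell 2))) (PMap 2 (rnat 0)).

Definition pstep : prog :=
  PSeq ppick
    (PIf (BNLe (NAdd (cell 4) (NConst 1)) (cell 0))
      (PSeq paim
        (PIf (BNLe (NAdd (cell 5) (NConst 1)) (cell 0)) padvance pstop))
      pskip).

Definition pnormalize : prog :=
  PSeq (PSum 3 (rsq (entry 1 (cell 3) (NConst 0))))
    (PMap 1 (RDiv (entry 1 (cell 1) (cell 2))
                  (RSqrt (entry 3 (NConst 0) (NConst 0))))).

Definition pwalk : prog := PSeq pinit (PSeq (PFor 6 pstep) pnormalize).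

(** * Correctness of the program *)

Section Step.
Variables (R : realType) (n : nat) (W : 'M[R]_n.+1).
Implicit Types (s t : state R) (E : nat -> 'M[R]_n.+1) (nu : nat -> nat).

Lemma run_PIf_ltn s c p q :
  run (PIf (BNLe (NAdd (cell c) (NConst 1)) (cell 0)) p q) s =
  if (nmem s c < nmem s 0)%N then run p s else run q s.
Proof. by rewrite [LHS]/= addn1. Qed.

Lemma slack_formE x y : slack_form W x y =
  \sum_k (2 * (x k 0 * y k 0) - (W *m x) k 0 * (W *m y) k 0).
Proof. by rewrite /slack_form /dot mulr_sumr -sumrB. Qed.

Lemma slackE x : slack W x =
  \sum_k (2 * (x k 0 * x k 0) - (W *m x) k 0 * (W *m x) k 0).
Proof. exact: slack_formE. Qed.

Lemma mul_colE (A B : 'M[R]_n.+1) i j :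
  (A *m col j B) i 0 = \sum_k A i k * B k j.
Proof. by rewrite mxE; apply: eq_bigr => k _; rewrite mxE. Qed.

(** The parameter m, the number of columns scanned, makes this usable as a scan invariant; v = n.+1,
    the dimension, signals failure. *)
Definition pick_spec (Q : 'M[R]_n.+1) (m v : nat) :=
  (exists2 j : 'I_n.+1, v = j & 0 < slack W (col j Q)) \/
  (v = n.+1 /\ forall j : 'I_n.+1, (j < m)%N -> slack W (col j Q) <= 0).

Lemma run_ppick s E nu (x := col 0 (E 1%N)) (Q := E 2%N) :
  rep s E nu -> E 0%N = W ->
  exists E' v,
    [/\ rep (run ppick s) E' (upd nu 4 v), forall b, (b < 3)%N -> E' b = E b,
        forall k, E' 4%N k 0 = (W *m x) k 0,
        forall i j, E' 6%N i j = slack_form W x (col j Q)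
      & pick_spec Q n.+1 v].
Proof.
move=> sr EW; rewrite /ppick 4!run_PSeq.
set s1 := run _ s; set s2 := run _ s1; set s3 := run _ s2; set s4 := run _ s3.
pose E1 := upd E 3 (\matrix_(i, j) \sum_k W i k * Q k j).
have r1 : rep s1 E1 nu.
  apply: rep_PSum => // t i j k _ t1 t2 t3 _ tE /=.
  by rewrite t1 t2 t3 !matE !tE // EW.
pose E2 := upd E1 4 (\matrix_(i, j) \sum_k W i k * E 1%N k j).
have r2 : rep s2 E2 nu.
  apply: rep_PSum => // t i j k _ t1 t2 t3 _ tE /=.
  by rewrite t1 t2 t3 !matE !tE // /E1 /upd /= EW.
have E13 k j : E1 3%N k j = (W *m col j Q) k 0 by rewrite mul_colE mxE.
have E24 k : E2 4%N k 0 = (W *m x) k 0 by rewrite mul_colE mxE.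
(* The value does not depend on the row i: all rows of array 5, and likewise of array 6, agree, and
   the program reads row 0. *)
pose E3 := upd E2 5 (\matrix_(i, j) slack W (col j Q)).
have r3 : rep s3 E3 nu.
  rewrite (_ : E3 = upd E2 5 (\matrix_(i, j) \sum_k
    (2 * (Q k j * Q k j) - E1 3%N k j * E1 3%N k j))).
    apply: rep_PSum => // t i j k _ t1 t2 t3 _ tE /=.
    by rewrite t2 t3 !matE !tE.
  congr upd; apply/matrixP=> i j; rewrite !mxE slackE.
  by apply: eq_bigr => k _; rewrite -!E13 !mxE.
pose E4 := upd E3 6 (\matrix_(i, j) slack_form W x (col j Q)).
have r4 : rep s4 E4 nu.
  rewrite (_ : E4 = upd E3 6 (\matrix_(i, j) \sum_k
    (2 * (E 1%N k 0 * Q k j) - E2 4%N k 0 * E1 3%N k j))).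
    apply: rep_PSum => // t i j k _ t1 t2 t3 _ tE /=.
    by rewrite t2 t3 !(matE _ _ _ ord0) !matE !tE.
  congr upd; apply/matrixP=> i j; rewrite !mxE slack_formE.
  by apply: eq_bigr => k _; rewrite E24 -!E13 !mxE.
have [|||v vP r5] := rep_PScan (c := 4) (b := BNot (BRLe (entry 5 (NConst 0)
    (cell 1)) (rnat 0))) (I := pick_spec Q) _ r4.
- by [].
- by right.
- move=> t i v t1 [_ tE _] Iv /=.
  rewrite t1 (matE _ _ ord0) tE mxE -ltNge.
  case: ifP => [i0|/negbT]; first by left; exists i.
  rewrite -leNgt => i0; case: Iv => [[j -> j0]|[-> Iv]].
    by left; exists j.
  right; split=> // j; rewrite ltnS leq_eqVlt => /orP[/eqP ji|]; last exact: Iv.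
  by rewrite (_ : j = i) //; apply: val_inj.
exists E4, v; split=> //.
- by move=> [|[|[|]]].
- by move=> i j; rewrite mxE.
Qed.

Lemma slackN x : slack W (- x) = slack W x.
Proof.
by rewrite !slackE; apply: eq_bigr => k _; rewrite mulmxN !mxE !mulrNN.
Qed.

Lemma slack_formN x y : slack_form W x (- y) = - slack_form W x y.
Proof.
rewrite !slack_formE -sumrN; apply: eq_bigr => k _.
by rewrite mulmxN !mxE !mulrN -opprB opprK addrC.
Qed.

(** Rows with z = 0 must be skipped: there division by zero makes [hit_time] 0, which would
    spuriously be minimal. *)
Definition first_hit (v z : 'cV[R]_n.+1) (m c : nat) :=
  (exists j : 'I_n.+1, [/\ c = j, z j 0 != 0 & forall k : 'I_n.+1, (k < m)%N ->
     z k 0 != 0 -> hit_time (v j 0) (z j 0) <= hit_time (v k 0) (z k 0)]) \/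
  (c = n.+1 /\ forall k : 'I_n.+1, (k < m)%N -> z k 0 = 0).

Lemma run_paim s E nu (x := col 0 (E 1%N)) (Q := E 2%N) (i : 'I_n.+1) :
  rep s E nu -> E 0%N = W -> nu 4%N = i ->
  (forall k, E 4%N k 0 = (W *m x) k 0) ->
  (forall j k, E 6%N j k = slack_form W x (col k Q)) ->
  exists E' v (y : 'cV[R]_n.+1),
    [/\ rep (run paim s) E' (upd nu 5 v), forall b, (b < 3)%N -> E' b = E b,
        forall k l, E' 7%N k l = y k 0,
        forall k, E' 9%N k 0 = hit_time ((W *m x) k 0) ((W *m y) k 0)
      & [/\ y = col i Q \/ y = - col i Q, 0 <= slack_form W x y
          & first_hit (W *m x) (W *m y) n.+1 v]].
Proof.
move=> sr EW nu4 E4 E6; rewrite /paim 3!run_PSeq.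
set s1 := run (PIf _ _ _) s; set s2 := run _ s1; set s3 := run _ s2.
have [y [ydef yx r1]] : exists y : 'cV[R]_n.+1,
    [/\ y = col i Q \/ y = - col i Q, 0 <= slack_form W x y
      & rep s1 (upd E 7 (\matrix_(k, l) y k 0)) nu].
  rewrite /s1 /=; case: (sr) => _ sE sn.
  rewrite sn // nu4 (matE _ _ ord0) sE E6; case: ifPn => [i0|].
    exists (col i Q); split=> //; first by left.
    have [] := rep_PMap (e := entry 2 (cell 1) (cell 4)) (a := 7)
      (M := \matrix_(k, l) (col i Q) k 0) sr _ => //.
    move=> t k l t0 t1 t2 t3 tn tE _ /=.
    by rewrite t1 tn // nu4 !matE tE // !mxE.
  rewrite -ltNge => i0; exists (- col i Q); split; first by right.
    by rewrite slack_formN oppr_ge0 ltW.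
  have [] := rep_PMap (e := RSub (rnat 0) (entry 2 (cell 1) (cell 4))) (a := 7)
      (M := \matrix_(k, l) (- col i Q) k 0) sr _ => //.
  move=> t k l t0 t1 t2 t3 tn tE _ /=.
  by rewrite t1 tn // nu4 !matE tE // !mxE sub0r.
set E1 := upd _ _ _ in r1.
pose E2 := upd E1 8 (\matrix_(k, l) (W *m y) k 0).
have r2 : rep s2 E2 nu.
  rewrite (_ : E2 = upd E1 8 (\matrix_(k, l) \sum_j W k j * y j 0)).
    apply: rep_PSum => // t k l j _ t1 t2 t3 _ tE /=.
    by rewrite t1 t2 t3 !matE !tE // /E1 /upd /= EW mxE.
  by congr upd; apply/matrixP=> k l; rewrite !mxE.
pose E3 := upd E2 9 (\matrix_(k, l)
  hit_time ((W *m x) k 0) ((W *m y) k 0)).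
have r3 : rep s3 E3 nu.
  have [] := rep_PMap (a := 9) (e := RDiv (RSub (RSqrt (rsq (entry 8 (cell 1)
    (NConst 0)))) (RMul (entry 8 (cell 1) (NConst 0)) (entry 4 (cell 1)
    (NConst 0)))) (rsq (entry 8 (cell 1) (NConst 0)))) (M := \matrix_(k, l)
    hit_time ((W *m x) k 0) ((W *m y) k 0)) r2 _ => //.
  move=> t k l t0 t1 t2 t3 tn tE _ /=.
  rewrite [RHS]mxE -E4 /hit_time t1 !(matE _ _ _ ord0) !tE // /E2 /E1 /upd /=.
  by rewrite ![fun_of_matrix (\matrix_(_, _) _) _ _]mxE !expr2.
have [|||v vP r4] := rep_PScan (c := 5) (b := BAnd (BNot (BRLe
    (rsq (entry 8 (cell 1) (NConst 0))) (rnat 0)))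
    (BNot (BAnd (BNLe (NAdd (cell 5) (NConst 1)) (cell 0))
    (BRLe (entry 9 (cell 5) (NConst 0)) (entry 9 (cell 1) (NConst 0))))))
    (I := first_hit (W *m x) (W *m y)) _ r3.
- by [].
- by right.
- move=> t k v t1 [t0 tE tn] Iv /=.
  have t8 : rmem t 8 k 0 = (W *m y) k 0.
    by rewrite (matE _ _ _ ord0) tE /E3 /E2 /upd /= mxE.
  have t9 j : rmem t 9 (nat_of_ord j) 0 =
      hit_time ((W *m x) j 0) ((W *m y) j 0).
    by rewrite (matE _ _ _ ord0) tE /E3 /upd /= mxE.
  rewrite t1 t0 tn // /upd eqxx addn1 t8 t9 -expr2 -ltNge.
  (* The machine compares reals only by <=, so z <> 0 is tested as the failure of z^2 <= 0. *)
  rewrite lt_neqAle sqr_ge0 andbT eq_sym sqrf_eq0.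
  have lt_k (j : 'I_n.+1) : (j < k.+1)%N -> j = k \/ (j < k)%N.
    by rewrite ltnS leq_eqVlt => /orP[/eqP/val_inj ->|]; [left|right].
  case: eqP => /= [zk|/eqP zk].
    case: Iv => [[j [-> zj jmin]]|[-> z0]].
      left; exists j; split=> // l /lt_k[->|]; last exact: jmin.
      by rewrite zk eqxx.
    by right; split=> // l /lt_k[->|]; last exact: z0.
  case: Iv => [[j [-> zj jmin]]|[-> z0]].
    (* An earlier candidate survives ties and yields only to a strictly smaller hitting time. *)
    rewrite ltn_ord t9 /=; case: leP => /= jk.
      by left; exists j; split=> // l /lt_k[->|]; last exact: jmin.
    left; exists k; split=> // l /lt_k[->//|lk zl].
    by apply: le_trans (ltW jk) _; apply: jmin.
  rewrite ltnn /=; left; exists k; split=> // l /lt_k[->//|/z0 ->].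
  by rewrite eqxx.
exists E3, v, y; split=> //.
- by move=> [|[|[|]]].
- by move=> k l; rewrite mxE.
- by move=> k; rewrite mxE.
Qed.

Lemma sub_rank1E (Q : 'M[R]_n.+1) (g : 'cV[R]_n.+1) a k l :
  (Q - a *: (g *m g^T)) k l = Q k l - g k 0 * g l 0 / a^-1.
Proof. by rewrite !mxE big_ord1 !mxE invrK mulrC. Qed.

(** Array 2 is overwritten last, after g has been computed from the old Q; each entry is then
    updated from its own old value and from arrays 10 and 11. *)
Lemma run_padvance s E nu (x := col 0 (E 1%N)) (Q := E 2%N) (y : 'cV[R]_n.+1)
    (j : 'I_n.+1) (g := Q *m (row j W)^T) :
  rep s E nu -> E 0%N = W -> nu 5%N = j -> (forall k l, E 7%N k l = y k 0) ->
  exists E',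
    [/\ rep (run padvance s) E' nu, E' 0%N = W,
        col 0 (E' 1%N) = x + E 9%N j 0 *: y
      & E' 2%N = Q - (dot g g)^-1 *: (g *m g^T)].
Proof.
move=> sr EW nu5 E7; rewrite /padvance 3!run_PSeq.
set s1 := run _ s; set s2 := run _ s1; set s3 := run _ s2.
pose E1 := upd E 1 (\matrix_(k, l) (E 1%N k l + E 9%N j 0 * y k 0)).
have r1 : rep s1 E1 nu.
  have [] := rep_PMap (a := 1) (e := RAdd (entry 1 (cell 1) (cell 2))
    (RMul (entry 9 (cell 5) (NConst 0)) (entry 7 (cell 1) (cell 2))))
    (M := \matrix_(k, l) (E 1%N k l + E 9%N j 0 * y k 0)) sr _ => //.
  move=> t k l t0 t1 t2 t3 tn tE ta /=.
  by rewrite t1 t2 tn // nu5 (matE _ _ j ord0) !matE ta !tE // E7 mxE.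
pose E2 := upd E1 10 (\matrix_(k, l) g k 0).
have r2 : rep s2 E2 nu.
  rewrite (_ : E2 = upd E1 10 (\matrix_(k, l) \sum_i Q k i * W j i)).
    apply: rep_PSum => // t k l i _ t1 t2 t3 tn tE /=.
    by rewrite t1 t3 tn // nu5 !matE !tE // /E1 /upd /= EW.
  congr upd; apply/matrixP=> k l; rewrite !mxE.
  by apply: eq_bigr => i _; rewrite !mxE.
pose E3 := upd E2 11 (\matrix_(k, l) dot g g).
have r3 : rep s3 E3 nu.
  apply: rep_PSum => // t k l i _ t1 t2 t3 tn tE /=.
  rewrite t3 (matE _ _ i ord0) tE // /E2 /upd /=.
  by rewrite [fun_of_matrix (\matrix_(_, _) _) _ _]mxE.
have [|r4 _] := rep_PMap (a := 2) (e := RSub (entry 2 (cell 1) (cell 2))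
  (RDiv (RMul (entry 10 (cell 1) (NConst 0)) (entry 10 (cell 2) (NConst 0)))
    (entry 11 (NConst 0) (NConst 0))))
  (M := Q - (dot g g)^-1 *: (g *m g^T)) r3 _.
  move=> t k l t0 t1 t2 t3 tn tE ta /=.
  rewrite t1 t2 (matE _ _ k ord0) (matE _ _ l ord0).
  rewrite (matE (n := n.+1) _ _ ord0 ord0) matE.
  rewrite ta !tE // /E3 /E2 /E1 /upd /=.
  by rewrite ![fun_of_matrix (\matrix_(_, _) _) _ _]mxE sub_rank1E invrK.
exists (upd E3 2 (Q - (dot g g)^-1 *: (g *m g^T))); split=> //.
by apply/colP=> k; rewrite !mxE.
Qed.

Lemma run_pstop s E nu (y : 'cV[R]_n.+1) :
  rep s E nu -> (forall k l, E 7%N k l = y k 0) ->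
  exists E',
    [/\ rep (run pstop s) E' nu, E' 0%N = E 0%N, col 0 (E' 1%N) = y
      & E' 2%N = 0].
Proof.
move=> sr E7; rewrite /pstop run_PSeq; set s1 := run _ s.
have [|r1 _] := rep_PMap (a := 1) (e := entry 7 (cell 1) (cell 2))
  (M := \matrix_(k, l) y k 0) sr _.
  move=> t k l t0 t1 t2 t3 tn tE ta /=.
  by rewrite t1 t2 matE tE // E7 mxE.
have [|r2 _] := rep_PMap (a := 2) (e := rnat 0) (M := 0) r1 _.
  by move=> *; rewrite mxE.
exists (upd (upd E 1 (\matrix_(k, l) y k 0)) 2 0); split=> //.
by apply/colP=> k; rewrite !mxE.
Qed.

(** Either the walk has stopped at a solution, or at least half of the rows have been hit, or at
    least one row per step has been. After n.+1 steps the third case implies the second. *)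
Definition loop_inv E m :=
  E 0%N = W /\ ((E 2%N = 0 /\ good W (col 0 (E 1%N))) \/
    exists2 S, walk_inv W (col 0 (E 1%N)) (E 2%N) S
             & (n.+1 <= 2 * #|S|)%N \/ (m <= #|S|)%N).

Hypothesis W1 : \sum_j \sum_i W i j ^+ 2 <= n.+1%:R.

Lemma run_pstep s E nu m :
  rep s E nu -> loop_inv E m ->
  exists E' nu', rep (run pstep s) E' nu' /\ loop_inv E' m.+1.
Proof.
move=> sr [EW inv]; rewrite /pstep run_PSeq; set s1 := run _ s.
have [E1 [v [r1 E1E E14 E16 vP]]] := run_ppick sr EW; rewrite -/s1 in r1.
have E1W : E1 0%N = W by rewrite E1E.
rewrite run_PIf_ltn; have [-> _ ->] // := r1; rewrite {1}/upd eqxx.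
case: vP => [[i vE islack]|[vE noslack]]; subst v; last first.
  rewrite ltnn; exists E1, (upd nu 4 n.+1); split; first exact: rep_nset.
  rewrite /loop_inv !E1E //; split=> //.
  case: inv => [?|[S Sinv _]]; [by left|right; exists S => //; left].
  (* Without a column of positive slack, [exists_slack_gt0] forces [2 tr Q <= n.+1], so S already
     contains at least half of the rows. *)
  case: (Sinv) => pQ trQ _ _ _; rewrite -(ler_nat R) natrM.
  have [] := ltrP n.+1%:R (2 * \tr (E 2%N)) => [/(exists_slack_gt0 W1 pQ)|].
    by case=> j; rewrite ltNge noslack.
  lra.
rewrite ltn_ord run_PSeq; set s2 := run _ s1.
have [||E2 [c [y [r2 E2E E27 E29 [yP yx cP]]]]] :=
  run_paim (i := i) r1 E1W (erefl _).
- by rewrite (E1E 1%N).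
- by rewrite (E1E 1%N) ?(E1E 2%N).
rewrite -/s2 in r2; rewrite !E1E // in E29 yP yx cP.
have E2W : E2 0%N = W by rewrite E2E.
rewrite run_PIf_ltn; have [-> _ ->] // := r2; rewrite {1}/upd eqxx.
have yslack : 0 < slack W y by case: yP => ->; rewrite ?slackN.
case: inv => [[Q0 _]|[S Sinv Sm]].
  (* After stopping, Q = 0 and all its columns have slack 0, contrary to the choice of column i. *)
  move: islack; rewrite Q0 /slack.
  have -> : col i 0 = 0 :> 'cV[R]_n.+1 by apply/colP=> k; rewrite !mxE.
  by rewrite mulmx0 /dot big1 ?mulr0 ?subr0 ?ltxx // => k _; rewrite mxE mul0r.
case: cP => [[j [cj zj jmin]]|[cj z0]]; subst c; last first.
  rewrite ltnn; have [E3 [r3 E3W E31 E32]] := run_pstop r2 E27.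
  exists E3, (upd (upd nu 4 i) 5 n.+1); split=> //; split; first by rewrite E3W.
  left; split=> //; rewrite E31; apply: slack_good => //.
  by apply/colP=> k; rewrite z0 // mxE.
rewrite ltn_ord.
have [E3 [r3 E3W E31 E32]] := run_padvance r2 E2W (erefl _) E27.
exists E3, (upd (upd nu 4 i) 5 j); split=> //; split=> //; right.
have Qy : E 2%N *m y = y.
  have QQ : E 2%N *m col i (E 2%N) = col i (E 2%N).
    by case: Sinv => -[_ QQ] _ _ _ _; rewrite colE mulmxA QQ.
  by case: yP => ->; rewrite ?mulmxN QQ.
have [Sinv' jS] := walk_inv_step Sinv Qy (ltW yslack) yx zj
  (fun k => jmin k (ltn_ord k)).
(* S gains exactly one row, which preserves either lower bound on its size. *)
exists (j |: S); last by rewrite cardsU1 jS; lia.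
by rewrite E31 E32 (E2E 1%N) ?(E2E 2%N) ?(E1E 1%N) ?(E1E 2%N) ?E29.
Qed.

Lemma run_pnormalize s E nu (x := col 0 (E 1%N)) :
  rep s E nu ->
  exists2 E', rep (run pnormalize s) E' nu
            & col 0 (E' 1%N) = (Num.sqrt (dot x x))^-1 *: x.
Proof.
move=> sr; rewrite /pnormalize run_PSeq; set s1 := run _ s.
have r1 : rep s1 (upd E 3 (\matrix_(k, l) dot x x)) nu.
  rewrite (_ : upd _ _ _ = upd E 3 (\matrix_(k, l)
    \sum_i (E 1%N i 0 * E 1%N i 0))).
    apply: rep_PSum => // t k l i _ t1 t2 t3 _ tE /=.
    by rewrite t3 (matE _ _ _ ord0) tE.
  congr upd; apply/matrixP=> k l; rewrite !mxE.
  by apply: eq_bigr => i _; rewrite !mxE.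
have [|r2 _] := rep_PMap (a := 1) (e := RDiv (entry 1 (cell 1) (cell 2))
  (RSqrt (entry 3 (NConst 0) (NConst 0))))
  (M := \matrix_(k, l) (E 1%N k l / Num.sqrt (dot x x))) r1 _.
  move=> t k l t0 t1 t2 t3 tn tE ta /=.
  by rewrite t1 t2 (matE (n := n.+1) _ _ ord0 ord0) matE ta tE // /upd /= !mxE.
eexists; first exact: r2.
by apply/colP=> k; rewrite !mxE mulrC.
Qed.

Lemma walk_inv0 : walk_inv W 0 1%:M set0.
Proof.
split.
- by split; [exact: trmx1|exact: mulmx1].
- by rewrite mxtrace1 cards0 addr0.
- by move=> j; rewrite mulmx0 mxE expr0n.
- by move=> j; rewrite inE.
- by rewrite slackE big1 // => k _; rewrite mulmx0 !mxE !mul0r mulr0 subr0.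
Qed.

Lemma run_pwalk :
  exists x, [/\ good W x, wf pwalk
    & output n.+1 (run pwalk (input W)) = (Num.sqrt (dot x x))^-1 *: x].
Proof.
rewrite /pwalk 2!run_PSeq; set s0 := input W; set s1 := run _ s0.
set s2 := run _ s1.
have r0 : rep s0 (fun a => mat n.+1 s0 a) (nmem s0) by split.
have s0E a i j : mat n.+1 s0 a i j = if a is 0%N then W i j else 0.
  rewrite mxE /= !insubT //= => ? ?; case: a => //.
  by congr (W _ _); exact: val_inj.
have [|r1 _] := rep_PMap (a := 2) (e := ROfNat (NSub (NConst 1)
    (NAdd (NSub (cell 1) (cell 2)) (NSub (cell 2) (cell 1)))))
  (M := 1%:M) r0 _.
  move=> t k l t0 t1 t2 t3 tn tE ta /=; rewrite t1 t2 !mxE; congr (_%:R).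
  by case: (eqVneq k l) => [->|]; [lia|rewrite -val_eqE /=; lia].
rewrite -/s1 in r1; set E1 := upd _ _ _ in r1.
pose I m t := exists E nu, rep t E nu /\ loop_inv E m.
(* Cell 6 counts the steps of the walk; unlike cells 1 to 3 it is recorded in [nu], which must
   therefore be updated. *)
have rep6 t E nu m : rep t E nu -> rep (nset t 6 m) E (upd nu 6 m).
  case=> t0 tE tn; split=> [//|a|c c3] /=; first by rewrite -tE.
  by rewrite /upd tn.
have [s10 _ _] := r1.
have : I (nmem s1 0) s2.
  apply: run_PFor_ind => [|m t _ _ [E [nu [tr inv]]]].
    exists E1, (upd (nmem s0) 6 0); split; first exact: rep6.
    split; first by apply/matrixP=> k l; rewrite s0E.
    (* Array 1 is 0 in the input, so the walk starts at x = 0, with Q the identity and no row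
       hit. *)
    right; exists set0; last by right; rewrite cards0.
    rewrite (_ : col 0 _ = 0); first exact: walk_inv0.
    by apply/colP=> k; rewrite mxE s0E mxE.
  have [E' [nu' [r' inv']]] := run_pstep tr inv.
  by exists E', (upd nu' 6 m.+1); split=> //; exact: rep6.
rewrite s10 => -[E [nu [r2 [_ inv]]]].
have [E3 [s30 s3E _] E31] := run_pnormalize r2.
exists (col 0 (E 1%N)); split=> //; last first.
  by rewrite -E31 -s3E; apply/colP=> k; rewrite !mxE.
case: inv => [[]//|[S Sinv Sn]].
by apply: (walk_inv_good _ Sinv) => //; lia.
Qed.

Lemma good_normalize (x : 'cV[R]_n.+1) (u := (Num.sqrt (dot x x))^-1 *: x) :
  good W x -> l2norm u = 1 /\ `|W *m u| <= 2 / Num.sqrt n.+1%:R.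
Proof.
case=> x0 xW; have sx0 : 0 < Num.sqrt (dot x x) by rewrite sqrtr_gt0.
split.
  rewrite /l2norm -[RHS]sqrtr1; congr Num.sqrt.
  have -> : \sum_i u i 0 ^+ 2 = (dot x x)^-1 * dot x x.
    rewrite [in RHS]/dot mulr_sumr; apply: eq_bigr => k _.
    by rewrite !mxE exprMn exprVn sqr_sqrtr ?ltW // expr2.
  by rewrite mulVf ?gt_eqF.
rewrite /Num.norm /= mx_normrE; apply: bigmax_le => [|[k l] _] /=.
  by rewrite divr_ge0 // sqrtr_ge0.
rewrite ord1 -scalemxAr mxE normrM gtr0_norm ?invr_gt0 //.
rewrite mulrC ler_pdivrMr // mulrAC ler_pdivlMr ?sqrtr_gt0 ?ltr0n //.
(* Both sides are nonnegative, so squares may be compared; the 4 in [good] is the square of the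
   constant 2. *)
rewrite -[leRHS]ger0_norm ?mulr_ge0 ?sqrtr_ge0 //.
rewrite -[leLHS]ger0_norm ?mulr_ge0 ?sqrtr_ge0 //.
rewrite -ler_sqr ?nnegrE // !real_normK ?num_real // !exprMn.
rewrite !sqr_sqrtr ?ler0n ?(ltW x0) //.
by rewrite real_normK ?num_real //; have := xW k; lra.
Qed.

End Step.

Theorem theorem10 (R : realType) :
  exists (P : cmd) (C : R) (p : {poly nat}),
    forall (n : nat) (w : 'I_n -> 'cV[R]_n),
      (0 < n)%N -> (forall i, l2norm (w i) <= 1) ->
      let W : 'M[R]_n := \matrix_(i, j) w j i 0 in
      exists (t : nat) (s : state R),
        let x : 'cV[R]_n := output n s in
        [/\ exec P (input W) t s,
            (t <= p.[n]%R)%N,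
            l2norm x = 1
          & `|W *m x| <= C / Num.sqrt n%:R].
Proof.
exists (compile pwalk), 2, (cost pwalk) => -[//|n] w _ w1 W.
(* The bounds on the columns enter the walk as a bound on the squared Frobenius norm. *)
have W1 : \sum_j \sum_i W i j ^+ 2 <= n.+1%:R.
  have -> : n.+1%:R = \sum_(j < n.+1) 1 :> R by rewrite sumr_const card_ord.
  apply: ler_sum => j _.
  have := w1 j; rewrite /l2norm -{1}sqrtr1 ler_sqrt // => wj.
  by under eq_bigr => i _ do rewrite mxE.
have [x [xW pwf xE]] := run_pwalk W1.
have [t tE tle] := exec_run (input W) pwf.
exists t, (run pwalk (input W)); rewrite xE.
by have [] := good_normalize xW; split.
Qed.
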